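(* Let $k \geq 3$ be an odd integer. There is a constant $c_k > 0$ depending only on $k$ such that for every integer $n > 1$ there exist a set $P$ of $n$ points in the Euclidean plane $\mathbb{R}^2$ and a set $\mathcal{L}$ of $n$ lines in $\mathbb{R}^2$ such that the incidence graph $G = (P \cup \mathcal{L}, I(P,\mathcal{L}))$ has girth at least $k+5$ and \[ |I(P,\mathcal{L})| \geq c_k\, n^{1+\frac{4}{k^2+6k-3}}. \]
   Context: For a finite set $P$ of points and a finite set $\mathcal{L}$ of lines in the plane, $I(P,\mathcal{L}) = \{(p,\ell) \in P \times \mathcal{L} : p \in \ell\}$ is the set of incidences. The incidence graph of $(P,\mathcal{L})$ is the bipartite graph with vertex classes $P$ and $\mathcal{L}$ whose edge set is $I(P,\mathcal{L})$, i.e. $p \in P$ is adjacent to $\ell \in \mathcal{L}$ iff $p \in \ell$. The girth of a graph is the length of its shortest cycle (infinite if the graph has no cycle); ''girth at least $k+5$'' means the graph contains no cycle of length less than $k+5$. *)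

(* Defs.v *)
From Stdlib Require Import Reals List Arith.
Open Scope R_scope.

Definition point : Type := (R * R)%type.

Definition line : Type := (R * R * R)%type.

Definition is_line (l : line) : Prop :=
  let '(a, b, _) := l in ~ (a = 0 /\ b = 0).

Definition on_line (p : point) (l : line) : Prop :=
  let '(a, b, c) := l in let '(x, y) := p in a * x + b * y + c = 0.

Definition same_line (l1 l2 : line) : Prop :=
  forall p : point, on_line p l1 <-> on_line p l2.

Definition pt0 : point := (0, 0).
Definition ln0 : line := (0, 0, 0).

Definition distinct_points (P : list point) : Prop := NoDup P.

Definition distinct_lines (L : list line) : Prop :=
  (forall j, (j < length L)%nat -> is_line (nth j L ln0)) /\
  (forall i j, (i < j)%nat -> (j < length L)%nat ->
     ~ same_line (nth i L ln0) (nth j L ln0)).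

Definition inc_ind (p : point) (l : line) : nat :=
  let '(a, b, c) := l in let '(x, y) := p in
  if Req_EM_T (a * x + b * y + c) 0 then 1%nat else 0%nat.

Definition num_incidences (P : list point) (L : list line) : nat :=
  list_sum (map (fun p => list_sum (map (fun l => inc_ind p l) L)) P).

Definition has_cycle_of_length {V : Type} (adj : V -> V -> Prop) (m : nat) : Prop :=
  (3 <= m)%nat /\
  exists f : nat -> V,
    (forall i j, (i < m)%nat -> (j < m)%nat -> f i = f j -> i = j) /\
    (forall i, (i < m)%nat -> adj (f i) (f ((i + 1) mod m))).

Definition girth_at_least {V : Type} (adj : V -> V -> Prop) (g : nat) : Prop :=
  forall m, has_cycle_of_length adj m -> (g <= m)%nat.

Definition incidence_adj (P : list point) (L : list line) (u v : nat + nat) : Prop :=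
  match u, v with
  | inl i, inr j | inr j, inl i =>
      (i < length P)%nat /\ (j < length L)%nat /\ on_line (nth i P pt0) (nth j L ln0)
  | _, _ => False
  end.

(* Main.v *)
(* Let r = (k + 3) / 2.  The incidence structure is a version over the integers
   of the Lazebnik-Ustimenko graphs D(k, q).  A vertex is a pair of power series
   v, w with constant term 1, v mod z^(r+1) and w mod z^r; an edge is the v of its
   point together with the w of its line.  Turning around a point adds a
   multiple of z v to w, turning around a line adds a multiple of z w to v.
   Walking s steps from an edge thus multiplies (v, w) by a product of
   elementary matrices of degree s in z; the two halves of a cycle of length 2s
   give products whose degrees differ, which is visible modulo z^(r+1) when
   s <= r.  So there is no cycle of length at most 2r = k + 3.

   The points of a fixed line are affine in one parameter, so the structure lives
   on straight lines in some R^D, and a generic projection moves it to the plane.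
   Bounding the entry of index j by about T^j yields of the order of T^e points
   and lines, with T points on each line, where e = r^2 - 3 = (k^2 + 6k - 3) / 4;
   isolated points and lines then bring both numbers to exactly n. *)
Require Import Defs.
From Stdlib Require Import Reals List Arith Lra Lia ZArith.
Open Scope R_scope.

(** * Continuants and the vectors carried along a walk *)

Definition delta0 (i : nat) : R := match i with 0%nat => 1 | S _ => 0 end.

(** Coefficients of the polynomials K_0 = K_1 = 1, K_(m+2) = K_m + c_m z K_(m+1). One polynomial
    serves for both starting vectors of a walk, because their coefficients occupy degrees of
    opposite parity. *)
Fixpoint cont (c : nat -> R) (m : nat) : nat -> R :=
  match m with
  | 0%nat => delta0
  | S m1 =>
      match m1 with
      | 0%nat => delta0
      | S m2 => fun i =>
          match i with
          | 0%nat => 1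
          | S j => cont c m2 (S j) + c m2 * cont c m1 j
          end
      end
  end.

Lemma cont_step (c : nat -> R) (m j : nat) :
  cont c (S (S m)) (S j) = cont c m (S j) + c m * cont c (S m) j.
Proof. reflexivity. Qed.

Lemma cont_0 (c : nat -> R) (m : nat) : cont c m 0%nat = 1.
Proof. destruct m as [|[|m]]; reflexivity. Qed.

Lemma cont_vanish (c : nat -> R) (m : nat) :
  forall i, (m <= i)%nat -> (0 < i)%nat -> cont c m i = 0.
Proof.
  induction m as [m IH] using lt_wf_ind; intros [|i] Hi Hi0; [lia|].
  destruct m as [|[|m]]; [reflexivity|reflexivity|].
  rewrite cont_step, (IH m), (IH (S m)) by lia. ring.
Qed.

(** In degree m of K_(m+1) only the product of c_0, ..., c_(m-1) survives. *)
Lemma cont_lead (c : nat -> R) (m : nat) :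
  (forall i, (i < m)%nat -> c i <> 0) -> cont c (S m) m <> 0.
Proof.
  induction m as [|m IH]; intros Hc; [simpl; lra|].
  rewrite cont_step, cont_vanish, Rplus_0_l by lia.
  apply Rmult_integral_contrapositive_currified; [apply Hc; lia|].
  apply IH; intros i Hi; apply Hc; lia.
Qed.

(** A Cauchy product whose second factor may change with the degree i of the first. *)
Definition conv (d : nat -> R) (q : nat -> nat -> R) (n : nat) : R :=
  sum_f_R0 (fun i => d i * q i (n - i)%nat) n.

Definition alt {A : Type} (x y : A) (i : nat) : A := if Nat.even i then x else y.

Lemma alt_SS {A : Type} (x y : A) (i : nat) : alt x y (S (S i)) = alt x y i.
Proof. reflexivity. Qed.

Lemma alt_S {A : Type} (x y : A) (i : nat) : alt x y (S i) = alt y x i.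
Proof. unfold alt. rewrite Nat.even_succ, <- Nat.negb_even. now destruct (Nat.even i). Qed.

(** The linear system for the coefficients is triangular with ones on the diagonal. *)
Lemma conv_inj (d e : nat -> R) (q : nat -> nat -> R) (N : nat) :
  (forall i, q i 0%nat = 1) ->
  (forall n, (n <= N)%nat -> conv d q n = conv e q n) ->
  forall n, (n <= N)%nat -> d n = e n.
Proof.
  intros Hq Heq n. induction n as [n IH] using lt_wf_ind; intros Hn.
  specialize (Heq n Hn). unfold conv in Heq. destruct n as [|n].
  - simpl in Heq. rewrite Hq in Heq. lra.
  - cbn [sum_f_R0] in Heq. rewrite Nat.sub_diag, Hq in Heq.
    assert (Hs : sum_f_R0 (fun i => d i * q i (S n - i)%nat) n =
                 sum_f_R0 (fun i => e i * q i (S n - i)%nat) n)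
      by (apply sum_eq; intros i Hi; now rewrite IH by lia).
    lra.
Qed.

(* A walk x_0, x_1, ... carries the vectors u_m, and u_(m+2) - u_m is c_m times
   the shift of u_(m+1); hence u_m is a combination of u_0 and u_1 with
   continuants of the c_m as coefficients.  The parity of the degree tells
   which of u_0 and u_1 a coefficient multiplies. *)
Lemma walk_conv (u : nat -> nat -> R) (c : nat -> R) (N : nat -> nat) (s : nat) :
  (forall m n, (m < s)%nat -> (S n <= N (S (S m)))%nat ->
     u (S (S m)) (S n) = u m (S n) + c m * u (S m) n) ->
  (forall m, u m 0%nat = 1) ->
  (forall m, N (S (S m)) = N m) ->
  (forall m, (N (S m) <= S (N m))%nat) ->
  forall m n, (m <= S s)%nat -> (n <= N m)%nat ->
    u m n = conv (cont c m) (fun i => alt (u 0%nat) (u 1%nat) (i + m)) n.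
Proof.
  intros Hrec H0 HN2 HN1 m.
  assert (Halt : forall i, alt (u 0%nat) (u 1%nat) i 0%nat = 1)
    by (intros i; unfold alt; destruct (Nat.even i); apply H0).
  assert (Hdelta : forall (q : nat -> nat -> R) n, conv delta0 q n = q 0%nat n).
  { intros q n. unfold conv. destruct n as [|n]; [simpl; ring|].
    rewrite decomp_sum by lia.
    rewrite (sum_eq _ (fun _ => 0)) by (intros; simpl; ring).
    rewrite sum_cte. simpl. ring. }
  induction m as [m IH] using lt_wf_ind; intros n Hm Hn.
  destruct m as [|[|m]]; [cbn [cont]; now rewrite Hdelta|cbn [cont]; now rewrite Hdelta|].
  destruct n as [|n].
  - unfold conv. cbn [sum_f_R0]. rewrite cont_0, H0, Halt. ring.
  - rewrite Hrec by lia.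
    (* Index [S n] is within [N m] because [N] has period 2, and index [n] is within [N (S m)]
       because [N] rises by at most one per step. *)
    rewrite (IH m), (IH (S m)) by (try rewrite HN2 in Hn; try specialize (HN1 (S m)); try rewrite HN2 in HN1; lia).
    unfold conv at 1 3. rewrite !(decomp_sum _ (S n)) by lia.
    rewrite !cont_0. simpl Nat.pred.
    unfold conv. rewrite scal_sum.
    rewrite Rplus_assoc, <- sum_plus.
    rewrite Nat.add_0_l, Nat.add_0_l, alt_SS. f_equal.
    apply sum_eq; intros i Hi. rewrite cont_step.
    replace (S i + S (S m))%nat with (S (S (S i + m))) by lia. rewrite alt_SS.
    replace (i + S m)%nat with (S i + m)%nat by lia. simpl (S n - S i)%nat. ring.
Qed.

(* Two walks leaving the same edge in opposite directions and meeting after s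
   steps express the same vector by continuants of degree s and s - 1. *)
Lemma walks_diverge (u y : nat -> nat -> R) (c c' : nat -> R) (N N' : nat -> nat) (s : nat) :
  (1 <= s)%nat ->
  (forall m n, (m < s)%nat -> (S n <= N (S (S m)))%nat ->
     u (S (S m)) (S n) = u m (S n) + c m * u (S m) n) ->
  (forall m n, (m < s)%nat -> (S n <= N' (S (S m)))%nat ->
     y (S (S m)) (S n) = y m (S n) + c' m * y (S m) n) ->
  (forall m, u m 0%nat = 1) -> (forall m, y m 0%nat = 1) ->
  (forall m, N (S (S m)) = N m) -> (forall m, (N (S m) <= S (N m))%nat) ->
  (forall m, N' (S (S m)) = N' m) -> (forall m, (N' (S m) <= S (N' m))%nat) ->
  (s <= N (S s))%nat -> (s <= N' s)%nat ->
  y 0%nat = u 1%nat -> y 1%nat = u 0%nat -> y s = u (S s) ->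
  (forall m, (m < s)%nat -> c m <> 0) -> False.
Proof.
  intros Hs Hu Hy Hu0 Hy0 HN2 HN1 HN2' HN1' HNs HNs' E0 E1 Es Hc.
  (* The comparison is made in degree s: there K_(s+1) of [c] has its nonzero leading coefficient,
     while K_s of [c'] has already ended. *)
  apply (cont_lead c s Hc).
  rewrite <- (cont_vanish c' s s) by lia.
  apply (conv_inj _ _ (fun i => alt (u 0%nat) (u 1%nat) (i + S s)) s); [| |lia].
  - intros i. unfold alt. destruct (Nat.even _); apply Hu0.
  - intros n Hn.
    rewrite <- (walk_conv u c N s Hu Hu0 HN2 HN1) by lia.
    rewrite <- Es, (walk_conv y c' N' s Hy Hy0 HN2' HN1') by lia.
    unfold conv. apply sum_eq; intros i Hi.
    (* Swapping the starting vectors makes up for the parity shift between [s] and [S s]. *)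
    rewrite E0, E1, Nat.add_succ_r, alt_S. reflexivity.
Qed.

(** * The incidence relation on pairs of series, and its girth *)

Definition config : Type := ((nat -> R) * (nat -> R))%type.

(** In series: v_p = v_l + p_1 z w_l modulo z^(r+1) and w_l = w_p + l_1 z v_p modulo z^r, where p_1
    is the v_1 of the point and l_1 the w_1 of the line. *)
Definition inc (r : nat) (p l : config) : Prop :=
  (forall j, (j < r)%nat -> fst p (S j) = fst l (S j) + fst p 1%nat * snd l j) /\
  (forall j, (S j < r)%nat -> snd l (S j) = snd p (S j) + snd l 1%nat * fst p j).

(** At a point, w matters only up to multiples of z v; w_1 = 0 picks the representative. For lines
    the roles of v and w are exchanged. *)
Definition pt_config (p : config) : Prop :=
  fst p 0%nat = 1 /\ snd p 0%nat = 1 /\ snd p 1%nat = 0.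

Definition ln_config (l : config) : Prop :=
  fst l 0%nat = 1 /\ snd l 0%nat = 1 /\ fst l 1%nat = 0.

Definition agree (r : nat) (p q : config) : Prop :=
  (forall j, (j <= r)%nat -> fst p j = fst q j) /\
  (forall j, (j < r)%nat -> snd p j = snd q j).

(** The line and v_1 give all of v by the first relation, and then w by the second. *)
Lemma inc_pt_unique (r : nat) (p q l : config) :
  pt_config p -> pt_config q -> inc r p l -> inc r q l ->
  fst p 1%nat = fst q 1%nat -> agree r p q.
Proof.
  intros (Hp0 & Hp1 & _) (Hq0 & Hq1 & _) [Hpv Hpw] [Hqv Hqw] E.
  assert (Hv : forall j, (j <= r)%nat -> fst p j = fst q j).
  { intros [|j] Hj; [congruence|]. rewrite Hpv, Hqv, E by lia. reflexivity. }
  split; [exact Hv|]. intros [|j] Hj; [congruence|].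
  specialize (Hpw j Hj). specialize (Hqw j Hj). rewrite Hv in Hpw by lia. lra.
Qed.

Lemma inc_ln_unique (r : nat) (p l m : config) :
  ln_config l -> ln_config m -> inc r p l -> inc r p m ->
  snd l 1%nat = snd m 1%nat -> agree r l m.
Proof.
  intros (Hl0 & Hl1 & _) (Hm0 & Hm1 & _) [Hlv Hlw] [Hmv Hmw] E.
  assert (Hw : forall j, (j < r)%nat -> snd l j = snd m j).
  { intros [|j] Hj; [congruence|]. rewrite Hlw, Hmw, E by lia. reflexivity. }
  split; [|exact Hw]. intros [|j] Hj; [congruence|].
  specialize (Hlv j Hj). specialize (Hmv j Hj). rewrite Hw in Hlv by lia. lra.
Qed.

Section Girth.

Variables (V : Type) (adj : V -> V -> Prop) (is_pt : V -> bool) (X : V -> config) (r : nat).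
Hypothesis r2 : (2 <= r)%nat.
Hypothesis adj_sym : forall u v, adj u v -> adj v u.
Hypothesis adj_type : forall u v, adj u v -> is_pt v = negb (is_pt u).
Hypothesis adj_inc : forall u v, adj u v -> is_pt u = true -> inc r (X u) (X v).
Hypothesis adj_pt : forall u v, adj u v -> is_pt u = true -> pt_config (X u).
Hypothesis adj_ln : forall u v, adj u v -> is_pt u = false -> ln_config (X u).
Hypothesis X_inj : forall u v w, adj u w -> adj v w -> agree r (X u) (X v) -> u = v.

(** The half of the pair that a turn around [u] leaves fixed; [bound u] is the last index at which
    the incidence relations control it. *)
Let vec (u : V) : nat -> R := if is_pt u then fst (X u) else snd (X u).
Let bound (u : V) : nat := if is_pt u then r else (r - 1)%nat.

Lemma vec_0 (u v : V) : adj u v -> vec u 0%nat = 1.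
Proof.
  intros H. unfold vec. destruct (is_pt u) eqn:E.
  - apply (adj_pt u v H E).
  - apply (adj_ln u v H E).
Qed.

(** Both [x] and [z] are incident with [y]; subtracting the two relations cancels the entry of [y]
    that they share. *)
Lemma vec_step (x y z : V) : adj x y -> adj y z ->
  forall n, (S n <= bound z)%nat ->
  vec z (S n) = vec x (S n) + (vec z 1%nat - vec x 1%nat) * vec y n.
Proof.
  intros Hxy Hyz n. pose proof (adj_type _ _ Hxy) as Txy. pose proof (adj_type _ _ Hyz) as Tyz.
  unfold bound, vec. rewrite Tyz, Txy. destruct (is_pt x) eqn:E; simpl; intros Hn.
  - rewrite Txy in Tyz. simpl in Tyz.
    destruct (adj_inc x y Hxy E) as [H1 _].
    destruct (adj_inc z y (adj_sym _ _ Hyz) Tyz) as [H2 _].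
    rewrite (H1 n), (H2 n) by lia. ring.
  - destruct (adj_inc y x (adj_sym _ _ Hxy) Txy) as [_ H1].
    destruct (adj_inc y z Hyz Txy) as [_ H2].
    rewrite (H1 n), (H2 n) by lia. ring.
Qed.

(** Among the neighbours of [y], the entry of index 1 determines the vertex, so a turn without
    backtracking has a nonzero coefficient. *)
Lemma vec_turn (x y z : V) : adj x y -> adj y z -> x <> z -> vec z 1%nat - vec x 1%nat <> 0.
Proof.
  intros Hxy Hyz Hne E. apply Hne, (X_inj x z y Hxy (adj_sym _ _ Hyz)).
  pose proof (adj_type _ _ Hxy) as Txy. pose proof (adj_type _ _ Hyz) as Tyz.
  pose proof (adj_sym _ _ Hyz) as Hzy. pose proof (adj_sym _ _ Hxy) as Hyx.
  unfold vec in E. rewrite Tyz, Txy in E. rewrite Txy in Tyz.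
  destruct (is_pt x) eqn:Ex; simpl in *.
  - apply inc_pt_unique with (X y); eauto; lra.
  - apply inc_ln_unique with (X y); eauto; lra.
Qed.

Lemma girth_of_inc : girth_at_least adj (2 * r + 2).
Proof.
  intros m (Hm & f & Hinj & Hadj).
  destruct (le_lt_dec (2 * r + 2) m) as [|Hlt]; [assumption|exfalso].
  (* The cycle is unrolled into an infinite periodic walk. *)
  set (g := fun i => f (i mod m)).
  assert (Hg : forall i, adj (g i) (g (S i))).
  { intros i. unfold g. replace (S i mod m) with ((i mod m + 1) mod m).
    - apply Hadj, Nat.mod_upper_bound; lia.
    - rewrite Nat.Div0.add_mod_idemp_l. f_equal; lia. }
  assert (Hg' : forall i, adj (g (S i)) (g i)) by (intros; apply adj_sym, Hg).
  assert (Hper : forall i, g (i + m)%nat = g i).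
  { intros i. unfold g. f_equal.
    rewrite <- Nat.Div0.add_mod_idemp_r, Nat.Div0.mod_same. f_equal; lia. }
  (* Since m is at least 3, i and i + 2 have different residues and the walk never backtracks. *)
  assert (Hne : forall i, g i <> g (S (S i))).
  { intros i E. unfold g in E.
    apply Hinj in E; try (apply Nat.mod_upper_bound; lia).
    pose proof (Nat.div_mod_eq i m) as D1. pose proof (Nat.div_mod_eq (S (S i)) m) as D2.
    rewrite <- E in D2.
    assert (m * (S (S i) / m) = m * (i / m) + 2)%nat by lia.
    assert (S (S i) / m <= i / m \/ i / m + 1 <= S (S i) / m)%nat as [|] by lia; nia. }
  assert (Hty : forall i, is_pt (g i) = xorb (is_pt (g 0%nat)) (Nat.odd i)).
  { induction i as [|i IH]; [now destruct (is_pt (g 0%nat))|].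
    rewrite (adj_type _ _ (Hg i)), IH, Nat.odd_succ, <- Nat.negb_odd.
    now destruct (is_pt (g 0%nat)), (Nat.odd i). }
  assert (Heven : Nat.even m = true).
  { pose proof (Hty m) as H. rewrite <- (Nat.add_0_l m), Hper in H. simpl in H.
    rewrite <- Nat.negb_odd. now destruct (is_pt (g 0%nat)), (Nat.odd m). }
  apply Nat.even_spec in Heven. destruct Heven as [s Hs].
  (* The start is chosen so that the two halves meet at a point: only at points do the vectors reach
     index r, and s may equal r. *)
  assert (Ho : exists o, is_pt (g (o + S s)%nat) = true).
  { destruct (is_pt (g (S s))) eqn:E; [now exists 0%nat|exists 1%nat].
    simpl. now rewrite (adj_type _ _ (Hg (S s))), E. }
  destruct Ho as [o Ho].
  assert (HSS : forall i, is_pt (g (S (S i))) = is_pt (g i))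
    by (intros i; rewrite (adj_type _ _ (Hg (S i))), (adj_type _ _ (Hg i)); now destruct (is_pt (g i))).
  (* Both walks leave the edge between [g o] and [g (o + 1)], one forwards and one backwards, and
     meet at [g (o + S s)]. Adding the period m keeps the backward indices clear of truncated
     subtraction as far as the meeting point. *)
  apply (walks_diverge
    (fun i => vec (g (o + i)%nat)) (fun i => vec (g (o + 1 + m - i)%nat))
    (fun i => vec (g (o + S (S i))%nat) 1%nat - vec (g (o + i)%nat) 1%nat)
    (fun i => vec (g (o + 1 + m - S (S i))%nat) 1%nat - vec (g (o + 1 + m - i)%nat) 1%nat)
    (fun i => bound (g (o + i)%nat)) (fun i => bound (g (o + S i)%nat)) s).
  - lia.
  - intros i n Hi Hn. rewrite !Nat.add_succ_r in *. apply vec_step; auto.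
  - intros i n Hi Hn.
    (* The backward bound was stated with forward indices, which keeps it periodic for all i; the
       two indices have the same parity. *)
    assert (Hb : bound (g (o + 1 + m - S (S i))%nat) = bound (g (o + S i)%nat)).
    { unfold bound. rewrite (Hty (o + 1 + m - S (S i))%nat), (Hty (o + S i)%nat).
      replace (Nat.odd (o + 1 + m - S (S i))) with (Nat.odd (o + S i)); [reflexivity|].
      rewrite <- (Nat.odd_add_mul_2 (o + 1 + m - S (S i)) (S i)).
      rewrite <- (Nat.odd_add_mul_2 (o + S i) s). f_equal. lia. }
    apply vec_step.
    + replace (o + 1 + m - i)%nat with (S (o + 1 + m - S i)) by lia. apply Hg'.
    + replace (o + 1 + m - S i)%nat with (S (o + 1 + m - S (S i))) by lia. apply Hg'.
    + rewrite Hb. unfold bound in *. rewrite !Nat.add_succ_r, !HSS in *. exact Hn.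
  - intros i. apply vec_0 with (g (S (o + i))). apply Hg.
  - intros i. apply vec_0 with (g (S (o + 1 + m - i))). apply Hg.
  - intros i. unfold bound. now rewrite !Nat.add_succ_r, HSS.
  - intros i. unfold bound. destruct (is_pt (g (o + S i)%nat)), (is_pt (g (o + i)%nat)); lia.
  - intros i. unfold bound. now rewrite !Nat.add_succ_r, HSS.
  - intros i. unfold bound.
    destruct (is_pt (g (o + S (S i))%nat)), (is_pt (g (o + S i)%nat)); lia.
  - unfold bound. rewrite Ho. lia.
  - unfold bound. rewrite Ho. lia.
  - rewrite Nat.sub_0_r, Hper. reflexivity.
  - replace (o + 1 + m - 1)%nat with (o + 0 + m)%nat by lia. now rewrite Hper.
  - f_equal. f_equal. lia.
  - intros i Hi. rewrite !Nat.add_succ_r. apply vec_turn with (g (S (o + i))); auto.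
Qed.

End Girth.

(** * Generic projection to the plane *)

Definition eventually (Q : R -> Prop) : Prop := exists M, forall x, M < x -> Q x.

Lemma eventually_and (Q1 Q2 : R -> Prop) :
  eventually Q1 -> eventually Q2 -> eventually (fun x => Q1 x /\ Q2 x).
Proof.
  intros [M1 H1] [M2 H2]. exists (Rmax M1 M2). intros x Hx.
  pose proof (Rmax_l M1 M2). pose proof (Rmax_r M1 M2).
  split; [apply H1 | apply H2]; lra.
Qed.

Lemma eventually_mono (Q1 Q2 : R -> Prop) :
  (forall x, Q1 x -> Q2 x) -> eventually Q1 -> eventually Q2.
Proof. intros H [M HM]. exists M. auto. Qed.

Lemma eventually_In {A : Type} (S : list A) (Q : A -> R -> Prop) :
  (forall a, In a S -> eventually (Q a)) ->
  eventually (fun x => forall a, In a S -> Q a x).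
Proof.
  induction S as [|a S IH]; intros H; [exists 0; intros x _ a []|].
  assert (Ha : eventually (Q a)) by (apply H; now left).
  assert (HS : eventually (fun x => forall b, In b S -> Q b x)) by (apply IH; intros; apply H; now right).
  apply eventually_mono with (2 := eventually_and _ _ Ha HS).
  intros x [H1 H2] b [<-|Hb]; auto.
Qed.

Lemma eventually_ex (Q : R -> Prop) : eventually Q -> exists x, Q x.
Proof. intros [M HM]. exists (M + 1). apply HM. lra. Qed.

Fixpoint peval (x : R) (l : list R) : R :=
  match l with nil => 0 | a :: t => a + x * peval x t end.

Lemma peval_zero (x : R) (l : list R) : (forall a, In a l -> a = 0) -> peval x l = 0.
Proof.
  induction l as [|a l IH]; intros H; [reflexivity|simpl].
  rewrite (H a (or_introl eq_refl)), IH; [ring|]. intros b Hb; apply H; now right.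
Qed.

Lemma peval_map_lin {A : Type} (x a b : R) (f g h : A -> R) (s : list A) :
  (forall i, In i s -> h i = a * f i + b * g i) ->
  peval x (map h s) = a * peval x (map f s) + b * peval x (map g s).
Proof.
  induction s as [|i s IH]; intros H; simpl; [ring|].
  rewrite IH by (intros; apply H; now right). rewrite (H i) by now left. ring.
Qed.

(** A polynomial with a nonzero coefficient has no large roots. *)
Lemma peval_eventually_neq0 (l : list R) (a : R) :
  In a l -> a <> 0 -> eventually (fun x => peval x l <> 0).
Proof.
  intros Ha Ha0.
  (* Induction along the Horner scheme needs a uniform lower bound: once x times the tail exceeds
     |b| + 1 in absolute value, adding b leaves at least 1. *)
  assert (H : exists e, 0 < e /\ eventually (fun x => e <= Rabs (peval x l))).
  { revert a Ha Ha0. induction l as [|b l IH]; intros a Ha Ha0; [destruct Ha|].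
    destruct (List.Exists_dec (fun c => c <> 0) l) as [Hl|Hl].
    { intros c. destruct (Req_EM_T c 0); [right|left]; tauto. }
    - apply Exists_exists in Hl. destruct Hl as (c & Hc & Hc0).
      destruct (IH c Hc Hc0) as (e & He & M & HM).
      exists 1. split; [lra|]. exists (Rmax M ((Rabs b + 1) / e)). intros x Hx.
      pose proof (Rmax_l M ((Rabs b + 1) / e)). pose proof (Rmax_r M ((Rabs b + 1) / e)).
      specialize (HM x ltac:(lra)). simpl.
      assert (Hd : (Rabs b + 1) / e * e < x * e) by (apply Rmult_lt_compat_r; lra).
      replace ((Rabs b + 1) / e * e) with (Rabs b + 1) in Hd by (field; lra).
      pose proof (Rabs_pos b).
      assert (0 < x) by (apply Rmult_lt_reg_r with e; lra).
      pose proof (Rabs_triang_inv (x * peval x l) (- b)) as Ht.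
      rewrite Rabs_Ropp, Rabs_mult, (Rabs_pos_eq x) in Ht by lra.
      replace (x * peval x l - - b) with (b + x * peval x l) in Ht by ring.
      assert (x * e <= x * Rabs (peval x l)) by (apply Rmult_le_compat_l; lra). lra.
    - assert (Hz : forall c, In c l -> c = 0).
      { intros c Hc. destruct (Req_EM_T c 0); [assumption|].
        exfalso; apply Hl, Exists_exists; eauto. }
      destruct Ha as [<-|Ha]; [|now specialize (Hz a Ha)].
      exists (Rabs b). split; [now apply Rabs_pos_lt|]. exists 0. intros x _. simpl.
      rewrite peval_zero by assumption. rewrite Rmult_0_r, Rplus_0_r. lra. }
  destruct H as (e & He & H). apply eventually_mono with (2 := H).
  intros x Hx E. rewrite E, Rabs_R0 in Hx. lra.
Qed.

(** The r + 1 entries of v followed by the r entries of w, as a vector in R^(2r+1). *)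
Definition coord (r : nat) (p : config) (i : nat) : R :=
  if (i <=? r)%nat then fst p i else snd p (i - S r)%nat.

Lemma agree_coord (r : nat) (p q : config) :
  agree r p q <-> forall i, In i (seq 0 (2 * r + 1)) -> coord r p i = coord r q i.
Proof.
  unfold coord. split.
  - intros [H1 H2] i Hi. apply in_seq in Hi.
    destruct (Nat.leb_spec i r); [apply H1|apply H2]; lia.
  - intros H. split; intros j Hj.
    + specialize (H j ltac:(apply in_seq; lia)). destruct (Nat.leb_spec j r); [assumption|lia].
    + specialize (H (S r + j)%nat ltac:(apply in_seq; lia)).
      destruct (Nat.leb_spec (S r + j) r); [lia|].
      now replace (S r + j - S r)%nat with j in H by lia.
Qed.

(** A linear functional with weights 1, x, x^2, ...; a large x makes it generic. *)
Definition height (x : R) (r : nat) (p : config) : R :=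
  peval x (map (coord r p) (seq 0 (2 * r + 1))).

Lemma height_agree (x : R) (r : nat) (p q : config) : agree r p q -> height x r p = height x r q.
Proof.
  intros H. unfold height. f_equal. apply map_ext_in. now apply agree_coord.
Qed.

Lemma agree_dec (r : nat) (p q : config) : {agree r p q} + {~ agree r p q}.
Proof.
  destruct (Forall_Exists_dec (fun i => coord r p i = coord r q i)
    (fun i => Req_EM_T _ _) (seq 0 (2 * r + 1))) as [H|H].
  - left. apply agree_coord. now apply Forall_forall.
  - right. intros Ha. apply Exists_exists in H. destruct H as (i & Hi & H).
    apply H. now apply agree_coord with (1 := Ha).
Qed.

(** For two configurations that disagree, the difference of heights is a nonzero polynomial in x,
    and there are finitely many pairs. *)
Lemma height_generic (r : nat) (S : list config) :
  eventually (fun x => forall p, In p S -> forall q, In q S ->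
    height x r p = height x r q -> agree r p q).
Proof.
  apply eventually_In; intros p Hp. apply eventually_In; intros q Hq.
  destruct (agree_dec r p q) as [H|H]; [exists 0; intros; assumption|].
  assert (Hex : exists i, In i (seq 0 (2 * r + 1)) /\ coord r p i <> coord r q i).
  { destruct (Forall_Exists_dec (fun i => coord r p i = coord r q i)
      (fun i => Req_EM_T _ _) (seq 0 (2 * r + 1))) as [H'|H'].
    - exfalso. apply H, agree_coord. now apply Forall_forall.
    - apply Exists_exists in H'. destruct H' as (i & Hi & H'). eauto. }
  destruct Hex as (i & Hi & Hne).
  assert (Hd : eventually (fun x =>
    peval x (map (fun i => coord r p i - coord r q i) (seq 0 (2 * r + 1))) <> 0)).
  { apply peval_eventually_neq0 with (coord r p i - coord r q i); [|lra].
    apply in_map_iff; eauto. }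
  apply eventually_mono with (2 := Hd). intros x Hx E. exfalso. apply Hx.
  rewrite (peval_map_lin x 1 (-1) (coord r p) (coord r q)) by (intros; ring).
  unfold height in E. lra.
Qed.

(** The relations of [inc] solved for the point with v_1 = b; every entry is affine in b, so the
    points of [l] lie on a straight line. *)
Definition line_pt (l : config) (b : R) : config :=
  let v := fun j => match j with 0%nat => 1 | S i => fst l (S i) + b * snd l i end in
  (v, fun j => match j with 0%nat => 1 | S i => snd l (S i) - snd l 1%nat * v i end).

Lemma line_pt_affine (x : R) (r : nat) (l : config) (b : R) :
  height x r (line_pt l b) =
  (1 - b) * height x r (line_pt l 0) + b * height x r (line_pt l 1).
Proof.
  unfold height. apply peval_map_lin. intros i _. unfold coord.
  destruct (i <=? r)%nat.
  - destruct i; simpl; ring.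
  - destruct (i - S r)%nat as [|[|j]]; simpl; ring.
Qed.

Lemma inc_line_pt (r : nat) (p l : config) : (1 <= r)%nat -> pt_config p -> ln_config l ->
  inc r p l <-> agree r p (line_pt l (fst p 1%nat)).
Proof.
  intros Hr (Hp0 & Hp1 & _) Hl. split.
  - intros [Hv Hw].
    assert (Hv' : forall j, (j <= r)%nat -> fst p j = fst (line_pt l (fst p 1%nat)) j)
      by (intros [|j] Hj; [assumption|apply Hv; lia]).
    split; [assumption|]. intros [|j] Hj; [assumption|].
    specialize (Hw j Hj). rewrite (Hv' j) in Hw by lia. simpl in Hw |- *. lra.
  - intros [Hv Hw]. split; intros j Hj.
    + apply (Hv (S j)). lia.
    + rewrite (Hw (S j)) by lia. rewrite (Hv j) by lia. simpl. ring.
Qed.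

(** Parameter 0 reveals the v of the line, and the increment up to parameter 1 is z times its w. *)
Lemma line_pt_inj (r : nat) (l m : config) : (1 <= r)%nat -> ln_config l -> ln_config m ->
  agree r (line_pt l 0) (line_pt m 0) -> agree r (line_pt l 1) (line_pt m 1) -> agree r l m.
Proof.
  intros Hr (Hl0 & Hl1 & _) (Hm0 & Hm1 & _) [H0 _] [H1 _].
  assert (Hv : forall j, (j <= r)%nat -> fst l j = fst m j).
  { intros [|j] Hj; [congruence|]. specialize (H0 (S j) Hj). simpl in H0. lra. }
  split; [assumption|]. intros j Hj.
  specialize (H1 (S j) Hj). simpl in H1. rewrite Hv in H1 by lia. lra.
Qed.

Definition plane_pt (x : R) (r : nat) (p : config) : point := (fst p 1%nat, height x r p).

(** The graph of the height along [l], interpolated from parameters 0 and 1; the coefficient -1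
    keeps it nondegenerate. *)
Definition plane_ln (x : R) (r : nat) (l : config) : line :=
  (height x r (line_pt l 1) - height x r (line_pt l 0), -1, height x r (line_pt l 0)).

Lemma on_plane_ln (x : R) (r : nat) (l : config) (a y : R) :
  on_line (a, y) (plane_ln x r l) <-> y = height x r (line_pt l a).
Proof. unfold on_line, plane_ln. rewrite (line_pt_affine x r l a). split; intros; lra. Qed.

Definition separated (r : nat) (S : list config) : Prop :=
  ForallOrdPairs (fun p q => ~ agree r p q) S.

Lemma separated_nth (r : nat) (S : list config) (d : config) : separated r S ->
  forall i j, (i < length S)%nat -> (j < length S)%nat ->
  agree r (nth i S d) (nth j S d) -> i = j.
Proof.
  intros H. induction H as [|p S Hp HS IH]; intros i j Hi Hj E; [simpl in Hi; lia|].
  rewrite Forall_forall in Hp. simpl in Hi, Hj.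
  destruct i as [|i], j as [|j]; simpl in E; [reflexivity| | |].
  - exfalso. apply (Hp (nth j S d)); [apply nth_In; lia|assumption].
  - exfalso. apply (Hp (nth i S d)); [apply nth_In; lia|].
    destruct E as [E1 E2]. split; intros; symmetry; auto.
  - f_equal. apply IH; [lia|lia|assumption].
Qed.

Lemma plane_realization (r : nat) (Pa La : list config) :
  (2 <= r)%nat -> Forall pt_config Pa -> Forall ln_config La ->
  separated r Pa -> separated r La ->
  exists x : R,
    let P := map (plane_pt x r) Pa in
    let L := map (plane_ln x r) La in
    NoDup P /\ distinct_lines L /\ girth_at_least (incidence_adj P L) (2 * r + 2).
Proof.
  intros Hr HP HL SP SL. rewrite Forall_forall in HP, HL.
  (* All configurations whose heights must be told apart: the points, two points of each line to
     distinguish lines, and the point of each line over each occurring abscissa to exclude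
     accidental incidences. *)
  set (Q := Pa ++ flat_map (fun l => line_pt l 0 :: line_pt l 1 ::
                 map (fun p => line_pt l (fst p 1%nat)) Pa) La).
  destruct (eventually_ex _ (height_generic r Q)) as [x Hx].
  assert (QP : forall p, In p Pa -> In p Q) by (intros; apply in_or_app; now left).
  assert (QL : forall l p, In l La ->
    In p (line_pt l 0 :: line_pt l 1 :: map (fun p => line_pt l (fst p 1%nat)) Pa) -> In p Q)
    by (intros l p Hl Hp; apply in_or_app; right; apply in_flat_map; eauto).
  set (d := (delta0, delta0) : config).
  assert (NP : forall i, (i < length Pa)%nat ->
    nth i (map (plane_pt x r) Pa) pt0 = plane_pt x r (nth i Pa d)).
  { intros i Hi. rewrite nth_indep with (d' := plane_pt x r d) by now rewrite length_map.
    apply map_nth. }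
  assert (NL : forall i, (i < length La)%nat ->
    nth i (map (plane_ln x r) La) ln0 = plane_ln x r (nth i La d)).
  { intros i Hi. rewrite nth_indep with (d' := plane_ln x r d) by now rewrite length_map.
    apply map_nth. }
  exists x. cbv zeta. repeat split.
  - apply (NoDup_nth _ pt0). rewrite length_map. intros i j Hi Hj E.
    rewrite !NP in E by assumption. apply (separated_nth r Pa d SP); [assumption..|].
    apply Hx; [apply QP, nth_In; assumption..|]. now injection E.
  - intros j Hj. rewrite length_map in Hj. rewrite NL by assumption.
    unfold is_line, plane_ln. lra.
  - intros i j Hij Hj E. rewrite length_map in Hj. rewrite !NL in E by lia.
    assert (Hil : In (nth i La d) La) by (apply nth_In; lia).
    assert (Hjl : In (nth j La d) La) by (apply nth_In; lia).
    assert (Hag : forall b, (b = 0 \/ b = 1) ->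
      agree r (line_pt (nth i La d) b) (line_pt (nth j La d) b)).
    { intros b Hb. apply Hx.
      - apply QL with (nth i La d); [assumption|]. simpl. destruct Hb as [-> | ->]; auto.
      - apply QL with (nth j La d); [assumption|]. simpl. destruct Hb as [-> | ->]; auto.
      - apply on_plane_ln with (a := b), E, on_plane_ln. reflexivity. }
    assert (i = j); [|lia].
    apply (separated_nth r La d SL); [lia|lia|].
    apply line_pt_inj; auto; lia.
  - assert (Hinc : forall i j, (i < length Pa)%nat -> (j < length La)%nat ->
      on_line (nth i (map (plane_pt x r) Pa) pt0) (nth j (map (plane_ln x r) La) ln0) ->
      inc r (nth i Pa d) (nth j La d)).
    { intros i j Hi Hj H. rewrite NP, NL in H by assumption. apply on_plane_ln in H.
      assert (Hip : In (nth i Pa d) Pa) by now apply nth_In.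
      assert (Hjl : In (nth j La d) La) by now apply nth_In.
      apply inc_line_pt; [lia|auto..|]. apply Hx; [auto| |assumption].
      apply QL with (nth j La d); [assumption|]. right; right.
      apply in_map_iff. eauto. }
    apply girth_of_inc with
      (is_pt := fun u => match u with inl _ => true | inr _ => false end)
      (X := fun u => match u with inl i => nth i Pa d | inr j => nth j La d end);
      unfold incidence_adj; rewrite ?length_map; try assumption.
    + intros [i|i] [j|j]; tauto.
    + intros [i|i] [j|j]; tauto.
    + intros [i|i] [j|j]; try discriminate; try tauto. intros (H1 & H2 & H3) _. auto.
    + intros [i|i] [j|j]; try discriminate; try tauto. intros (H1 & H2 & H3) _.
      now apply HP, nth_In.
    + intros [i|i] [j|j]; try discriminate; try tauto. intros (H1 & H2 & H3) _.
      now apply HL, nth_In.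
    + intros [i|i] [j|j] [k|k]; try tauto; intros (H1 & H2 & _) (H3 & H4 & _) H; f_equal.
      * now apply (separated_nth r Pa d SP).
      * now apply (separated_nth r La d SL).
Qed.

(** * Counting incidences line by line *)

Lemma on_line_inc_ind (p : point) (l : line) : on_line p l -> inc_ind p l = 1%nat.
Proof.
  destruct l as [[a b] c], p as [x y]. unfold on_line, inc_ind. intros H.
  destruct (Req_EM_T _ 0); tauto.
Qed.

Lemma list_sum_map_plus {A : Type} (f g : A -> nat) (s : list A) :
  list_sum (map (fun a => (f a + g a)%nat) s) = (list_sum (map f s) + list_sum (map g s))%nat.
Proof. induction s as [|a s IH]; simpl; lia. Qed.

Lemma list_sum_swap {A B : Type} (f : A -> B -> nat) (s : list A) (t : list B) :
  list_sum (map (fun a => list_sum (map (f a) t)) s) =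
  list_sum (map (fun b => list_sum (map (fun a => f a b) s)) t).
Proof.
  induction s as [|a s IH]; simpl.
  - induction t as [|b t IHt]; simpl; lia.
  - rewrite list_sum_map_plus. lia.
Qed.

Lemma points_on_line_le (P Q : list point) (l : line) :
  NoDup Q -> incl Q P -> (forall q, In q Q -> on_line q l) ->
  (length Q <= list_sum (map (fun p => inc_ind p l) P))%nat.
Proof.
  intros HQ HQP Hon.
  set (on := fun p => Nat.eqb (inc_ind p l) 1).
  apply Nat.le_trans with (length (filter on P)).
  - apply NoDup_incl_length; [assumption|]. intros q Hq. apply filter_In. split; [auto|].
    unfold on. now rewrite on_line_inc_ind by auto.
  - clear HQP. induction P as [|p P IH]; simpl; [lia|].
    unfold on at 1. destruct (Nat.eqb_spec (inc_ind p l) 1); simpl; lia.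
Qed.

Lemma num_incidences_ge (P : list point) (L : list line) (t : nat) :
  (forall l, In l L -> exists Q, NoDup Q /\ incl Q P /\
     (forall q, In q Q -> on_line q l) /\ (t <= length Q)%nat) ->
  (t * length L <= num_incidences P L)%nat.
Proof.
  intros H. unfold num_incidences. rewrite list_sum_swap.
  induction L as [|l L IH]; simpl; [lia|].
  destruct (H l) as (Q & H1 & H2 & H3 & H4); [now left|].
  pose proof (points_on_line_le P Q l H1 H2 H3).
  specialize (IH (fun m Hm => H m (or_intror Hm))). lia.
Qed.

Lemma num_incidences_app_l (P P' : list point) (L : list line) :
  (num_incidences P L <= num_incidences (P ++ P') L)%nat.
Proof. unfold num_incidences. rewrite map_app, list_sum_app. lia. Qed.

Lemma num_incidences_app_r (P : list point) (L L' : list line) :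
  (num_incidences P L <= num_incidences P (L ++ L'))%nat.
Proof.
  unfold num_incidences. induction P as [|p P IH]; simpl; [lia|].
  rewrite map_app, list_sum_app. lia.
Qed.

(** * Padding with isolated points and lines *)

Definition arrangement (g : nat) (P : list point) (L : list line) : Prop :=
  distinct_points P /\ distinct_lines L /\ girth_at_least (incidence_adj P L) g.

Lemma girth_mono {V : Type} (adj adj' : V -> V -> Prop) (g : nat) :
  (forall u v, adj' u v -> adj u v) -> girth_at_least adj g -> girth_at_least adj' g.
Proof.
  intros H Hg m (Hm & f & Hinj & Hf). apply Hg. split; [assumption|].
  exists f. auto.
Qed.

Lemma nth_app_last {A : Type} (S : list A) (a d : A) (i : nat) :
  (i < length (S ++ a :: nil))%nat ->
  (i < length S)%nat /\ nth i (S ++ a :: nil) d = nth i S d \/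
  i = length S /\ nth i (S ++ a :: nil) d = a.
Proof.
  rewrite length_app. simpl. intros Hi.
  destruct (Nat.eq_dec i (length S)) as [->|Hne]; [right|left].
  - split; [reflexivity|]. apply nth_middle.
  - split; [lia|]. apply app_nth1. lia.
Qed.

Lemma eventually_gt (M : R) : eventually (fun x => M < x).
Proof. exists M. auto. Qed.

(** A line meets the parabola y = x^2 in roots of a nonzero polynomial, so for large t the point (t,
    t^2) misses every line; an abscissa beyond all of [P] makes it new. *)
Lemma add_isolated_point (g : nat) (P : list point) (L : list line) :
  arrangement g P L -> exists q, arrangement g (P ++ q :: nil) L.
Proof.
  intros (HP & HL & Hg).
  assert (HE : eventually (fun t =>
    (forall l, In l L -> ~ on_line (t, t * t) l) /\ (forall p, In p P -> fst p < t))).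
  { apply eventually_and; apply eventually_In; [|intros p _; apply eventually_gt].
    intros l Hl. apply In_nth with (d := ln0) in Hl. destruct Hl as (j & Hj & <-).
    assert (Hln := proj1 HL j Hj). destruct (nth j L ln0) as [[a b] c]. simpl in Hln.
    assert (Hne : exists e, In e (c :: a :: b :: nil) /\ e <> 0).
    { destruct (Req_EM_T a 0); [exists b|exists a]; simpl; tauto. }
    destruct Hne as (e & He & He0).
    apply eventually_mono with (2 := peval_eventually_neq0 _ e He He0).
    intros t Ht E. apply Ht. simpl in E |- *.
    transitivity (a * t + b * (t * t) + c); [ring|exact E]. }
  destruct (eventually_ex _ HE) as (t & H1 & H2).
  pose (q := (t, t * t) : point). exists q. repeat split.
  - unfold distinct_points. apply NoDup_app; [assumption|repeat constructor; simpl; tauto|].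
    intros p Hp [<-|[]]. specialize (H2 _ Hp). simpl in H2. lra.
  - apply HL.
  - apply HL.
  - apply girth_mono with (2 := Hg). unfold incidence_adj.
    assert (H : forall i j, (i < length (P ++ q :: nil))%nat /\ (j < length L)%nat /\
      on_line (nth i (P ++ q :: nil) pt0) (nth j L ln0) ->
      (i < length P)%nat /\ (j < length L)%nat /\ on_line (nth i P pt0) (nth j L ln0)).
    { intros i j (Hi & Hj & H).
      destruct (nth_app_last P q pt0 i Hi) as [(Hi' & E) | (_ & E)]; rewrite E in H.
      - auto.
      - exfalso. apply (H1 (nth j L ln0)); [now apply nth_In|assumption]. }
    intros [i|i] [j|j]; auto.
Qed.

(** A horizontal line above all points carries none of them, and each old line equals the line y = t
    for at most one t. *)
Lemma add_isolated_line (g : nat) (P : list point) (L : list line) :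
  arrangement g P L -> exists l, arrangement g P (L ++ l :: nil).
Proof.
  intros (HP & HL & Hg).
  assert (HE : eventually (fun t =>
    (forall l, In l L -> ~ same_line l (0, 1, - t)) /\ (forall p, In p P -> snd p < t))).
  { apply eventually_and; apply eventually_In; [|intros p _; apply eventually_gt].
    intros l Hl. apply In_nth with (d := ln0) in Hl. destruct Hl as (j & Hj & <-).
    assert (Hln := proj1 HL j Hj). destruct (nth j L ln0) as [[a b] c]. simpl in Hln.
    assert (Hon : forall t, same_line (a, b, c) (0, 1, - t) -> a = 0 /\ c + t * b = 0).
    { intros t E. assert (E0 : on_line (0, t) (a, b, c)) by (apply E; simpl; ring).
      assert (E1 : on_line (1, t) (a, b, c)) by (apply E; simpl; ring).
      simpl in E0, E1. split; lra. }
    destruct (Req_EM_T b 0) as [->|Hb].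
    - exists 0. intros t _ E. apply Hon in E. tauto.
    - apply eventually_mono with
        (2 := peval_eventually_neq0 (c :: b :: nil) b (or_intror (or_introl eq_refl)) Hb).
      intros t Ht E. apply Ht. apply Hon in E. simpl. lra. }
  destruct (eventually_ex _ HE) as (t & H1 & H2).
  pose (m := (0, 1, - t) : line). exists m. repeat split.
  - exact HP.
  - intros j Hj. destruct (nth_app_last L m ln0 j Hj) as [(Hj' & ->) | (_ & ->)].
    + now apply HL.
    + simpl. lra.
  - intros i j Hij Hj.
    destruct (nth_app_last L m ln0 j Hj) as [(Hj' & ->) | (Ej & ->)].
    + rewrite app_nth1 by lia. now apply HL.
    + rewrite app_nth1 by lia. apply H1, nth_In. lia.
  - apply girth_mono with (2 := Hg). unfold incidence_adj.
    assert (H : forall i j, (i < length P)%nat /\ (j < length (L ++ m :: nil))%nat /\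
      on_line (nth i P pt0) (nth j (L ++ m :: nil) ln0) ->
      (i < length P)%nat /\ (j < length L)%nat /\ on_line (nth i P pt0) (nth j L ln0)).
    { intros i j (Hi & Hj & H).
      destruct (nth_app_last L m ln0 j Hj) as [(Hj' & E) | (_ & E)]; rewrite E in H.
      - auto.
      - exfalso. specialize (H2 _ (nth_In P pt0 Hi)).
        destruct (nth i P pt0) as [x y]. simpl in H, H2. lra. }
    intros [i|i] [j|j]; auto.
Qed.

Lemma pad_arrangement (g n : nat) (P : list point) (L : list line) :
  arrangement g P L -> (length P <= n)%nat -> (length L <= n)%nat ->
  exists P' L', arrangement g P' L' /\ length P' = n /\ length L' = n /\
    (num_incidences P L <= num_incidences P' L')%nat.
Proof.
  intros H HP HL.
  assert (HPn : exists P', arrangement g P' L /\ length P' = n /\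
    (num_incidences P L <= num_incidences P' L)%nat).
  { remember (n - length P)%nat as e eqn:He. revert P H HP He.
    induction e as [|e IH]; intros P H HP He.
    - exists P. repeat split; try apply H; lia.
    - destruct (add_isolated_point g P L H) as [q Hq].
      destruct (IH _ Hq) as (P' & H1 & H2 & H3); try (rewrite length_app; simpl; lia).
      exists P'. pose proof (num_incidences_app_l P (q :: nil) L). repeat split; try apply H1; lia. }
  destruct HPn as (P' & HP' & Hn & Hinc). clear H HP.
  assert (HLn : exists L', arrangement g P' L' /\ length L' = n /\
    (num_incidences P' L <= num_incidences P' L')%nat).
  { clear Hinc. remember (n - length L)%nat as e eqn:He. revert L HP' HL He.
    induction e as [|e IH]; intros L H HL He.
    - exists L. repeat split; try apply H; lia.
    - destruct (add_isolated_line g P' L H) as [l Hl].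
      destruct (IH _ Hl) as (L' & H1 & H2 & H3); try (rewrite length_app; simpl; lia).
      exists L'. pose proof (num_incidences_app_r P' L (l :: nil)). repeat split; try apply H1; lia. }
  destruct HLn as (L' & HL' & Hn' & Hinc').
  exists P', L'. repeat split; try apply HL'; lia.
Qed.

(** * Boxes of integer vectors *)

Definition zrange (b : nat) : list Z :=
  map (fun i => (Z.of_nat i - Z.of_nat b)%Z) (seq 0 (2 * b + 1)).

Lemma in_zrange (b : nat) (x : Z) : In x (zrange b) <-> (Z.abs x <= Z.of_nat b)%Z.
Proof.
  unfold zrange. rewrite in_map_iff. split.
  - intros (i & <- & Hi). apply in_seq in Hi. lia.
  - intros H. exists (Z.to_nat (x + Z.of_nat b)). rewrite in_seq. lia.
Qed.

Lemma NoDup_zrange (b : nat) : NoDup (zrange b).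
Proof. apply NoDup_map_NoDup_ForallPairs; [intros i j _ _; lia|apply seq_NoDup]. Qed.

Lemma length_zrange (b : nat) : length (zrange b) = (2 * b + 1)%nat.
Proof. unfold zrange. now rewrite length_map, length_seq. Qed.

Fixpoint box (bs : list nat) : list (list Z) :=
  match bs with
  | nil => nil :: nil
  | b :: bs => flat_map (fun x => map (cons x) (box bs)) (zrange b)
  end.

Lemma in_box (bs : list nat) (c : list Z) :
  In c (box bs) <-> Forall2 (fun x b => (Z.abs x <= Z.of_nat b)%Z) c bs.
Proof.
  revert c. induction bs as [|b bs IH]; intros c; simpl.
  - split; [intros [<-|[]]; constructor|]. intros H; inversion H; auto.
  - rewrite in_flat_map. split.
    + intros (x & Hx & Hc). apply in_map_iff in Hc. destruct Hc as (c' & <- & Hc').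
      constructor; [now apply in_zrange|now apply IH].
    + intros H. inversion H as [|x b' c' bs' Hx Hc]; subst. exists x.
      split; [now apply in_zrange|]. apply in_map, IH, Hc.
Qed.

Lemma NoDup_box (bs : list nat) : NoDup (box bs).
Proof.
  induction bs as [|b bs IH]; simpl; [repeat constructor; simpl; tauto|].
  assert (Hz := NoDup_zrange b). induction Hz as [|x s Hx Hs IHs]; simpl; [constructor|].
  apply NoDup_app; [|assumption|].
  - apply NoDup_map_NoDup_ForallPairs; [congruence|assumption].
  - intros c H1 H2. apply in_map_iff in H1. destruct H1 as (c1 & <- & _).
    apply in_flat_map in H2. destruct H2 as (y & Hy & H2).
    apply in_map_iff in H2. destruct H2 as (c2 & E & _). congruence.
Qed.

Lemma length_box_cons (b : nat) (bs : list nat) :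
  length (box (b :: bs)) = ((2 * b + 1) * length (box bs))%nat.
Proof.
  cbn [box]. rewrite (flat_map_constant_length (c := length (box bs))).
  - now rewrite length_zrange.
  - intros; apply length_map.
Qed.

(** Each side 2 K T^j + 1 lies between T^j and 3 K T^j. *)
Lemma length_box_powers (K T : nat) (js : list nat) : (1 <= K)%nat -> (1 <= T)%nat ->
  (T ^ list_sum js <= length (box (map (fun j => K * T ^ j) js)))%nat /\
  (length (box (map (fun j => K * T ^ j) js)) <= (3 * K) ^ length js * T ^ list_sum js)%nat.
Proof.
  intros HK HT. induction js as [|j js [IH1 IH2]]; [simpl; lia|].
  cbn [map]. rewrite length_box_cons. cbn [list_sum fold_right length].
  fold (list_sum js). rewrite Nat.pow_add_r, Nat.pow_succ_r'.
  assert (HTj : (1 <= T ^ j)%nat) by (pose proof (Nat.pow_nonzero T j); lia).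
  set (X := (T ^ j)%nat) in *. set (B := length _) in *.
  split.
  - apply Nat.mul_le_mono; [nia|assumption].
  - apply Nat.le_trans with ((3 * K * X) * ((3 * K) ^ length js * T ^ list_sum js))%nat; [|lia].
    apply Nat.mul_le_mono; [nia|assumption].
Qed.

(** * Integer codes of points and lines *)

(* A code lists v_1 (for a point) or w_1 (for a line), then v_2, ..., v_r and
   w_3, ..., w_(r-1); the entry of index j is of order T^j.  The entry w_2 is
   always -v_2: v_2 + w_2 - v_1 w_1 is constant along walks, so fixing it costs
   no incidences but saves a factor T^2 in the number of vertices. *)
Definition exponents (r : nat) : list nat := seq 1 r ++ seq 3 (r - 3).

Definition pt_v (c : list Z) (j : nat) : Z :=
  match j with 0%nat => 1%Z | S i => nth i c 0%Z end.

Definition ln_v (c : list Z) (j : nat) : Z :=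
  match j with 0%nat => 1%Z | 1%nat => 0%Z | S i => nth i c 0%Z end.

(** The entry w_(3+i) stands at position r + i, behind the r entries of the first block; w_1 is the
    parameter [x], since it is zero for points and coded for lines. *)
Definition common_w (r : nat) (x : Z) (c : list Z) (j : nat) : Z :=
  match j with
  | 0%nat => 1%Z
  | 1%nat => x
  | 2%nat => (- nth 1 c 0)%Z
  | S (S (S i)) => nth (r + i) c 0%Z
  end.

Definition pt_w (r : nat) (c : list Z) : nat -> Z := common_w r 0 c.

Definition ln_w (r : nat) (c : list Z) : nat -> Z := common_w r (nth 0 c 0%Z) c.

Definition pt_of (r : nat) (c : list Z) : config :=
  (fun j => IZR (pt_v c j), fun j => IZR (pt_w r c j)).

Definition ln_of (r : nat) (c : list Z) : config :=
  (fun j => IZR (ln_v c j), fun j => IZR (ln_w r c j)).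

Lemma pt_of_config (r : nat) (c : list Z) : pt_config (pt_of r c).
Proof. repeat split. Qed.

Lemma ln_of_config (r : nat) (c : list Z) : ln_config (ln_of r c).
Proof. repeat split. Qed.

Lemma code_ext (r : nat) (c c' : list Z) :
  length c = (r + (r - 3))%nat -> length c' = (r + (r - 3))%nat ->
  (forall i, (i < r)%nat -> nth i c 0%Z = nth i c' 0%Z) ->
  (forall i, (3 + i < r)%nat -> nth (r + i) c 0%Z = nth (r + i) c' 0%Z) -> c = c'.
Proof.
  intros Hc Hc' H1 H2. apply nth_ext with (d := 0%Z) (d' := 0%Z); [congruence|].
  intros i Hi. destruct (le_lt_dec r i) as [Hr|Hr]; [|auto].
  replace i with (r + (i - r))%nat by lia. apply H2. lia.
Qed.

Lemma pt_of_inj (r : nat) (c c' : list Z) :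
  length c = (r + (r - 3))%nat -> length c' = (r + (r - 3))%nat ->
  agree r (pt_of r c) (pt_of r c') -> c = c'.
Proof.
  intros Hc Hc' [Hv Hw]. apply code_ext with r; try assumption.
  - intros i Hi. apply eq_IZR, (Hv (S i) Hi).
  - intros i Hi. apply eq_IZR, (Hw (3 + i)%nat Hi).
Qed.

Lemma ln_of_inj (r : nat) (c c' : list Z) : (2 <= r)%nat ->
  length c = (r + (r - 3))%nat -> length c' = (r + (r - 3))%nat ->
  agree r (ln_of r c) (ln_of r c') -> c = c'.
Proof.
  intros Hr Hc Hc' [Hv Hw]. apply code_ext with r; try assumption.
  - intros [|i] Hi; apply eq_IZR; [apply (Hw 1%nat Hr)|apply (Hv (S (S i)) Hi)].
  - intros i Hi. apply eq_IZR, (Hw (3 + i)%nat Hi).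
Qed.

(** The integer form of [line_pt]: the code of the point with v_1 = x on the line coded by [c]. *)
Definition code_pt (r : nat) (c : list Z) (x : Z) : list Z :=
  let V := fun j => match j with 0%nat => 1%Z | S i => (ln_v c (S i) + x * ln_w r c i)%Z end in
  map V (seq 1 r) ++ map (fun j => ln_w r c j - ln_w r c 1 * V (j - 1)%nat)%Z (seq 3 (r - 3)).

Lemma nth_map_seq {A : Type} (f : nat -> A) (d : A) (a n i : nat) :
  (i < n)%nat -> nth i (map f (seq a n)) d = f (a + i)%nat.
Proof.
  intros Hi. rewrite nth_indep with (d' := f 0%nat) by now rewrite length_map, length_seq.
  now rewrite map_nth, seq_nth.
Qed.

Lemma pt_v_code_pt (r : nat) (c : list Z) (x : Z) (j : nat) : (S j <= r)%nat ->
  pt_v (code_pt r c x) (S j) = (ln_v c (S j) + x * ln_w r c j)%Z.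
Proof.
  intros Hj. unfold code_pt, pt_v.
  rewrite app_nth1 by (rewrite length_map, length_seq; lia).
  now rewrite nth_map_seq by lia.
Qed.

Lemma pt_w_code_pt (r : nat) (c : list Z) (x : Z) (j : nat) : (S j < r)%nat ->
  (ln_w r c (S j) = pt_w r (code_pt r c x) (S j) + ln_w r c 1 * pt_v (code_pt r c x) j)%Z.
Proof.
  intros Hj. destruct j as [|[|j]].
  - cbn. ring.
  (* Here w_2 is prescribed, so the relation has to be verified: the point has v_1 = x, and its v_2
     exceeds that of the line by x w_1, so -v_2 + w_1 x returns the w_2 of the line. *)
  - change (pt_w r (code_pt r c x) 2) with (- pt_v (code_pt r c x) 2)%Z.
    rewrite !pt_v_code_pt by lia. cbn. ring.
  - rewrite pt_v_code_pt by lia.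
    unfold pt_w at 1. unfold common_w, code_pt.
    rewrite app_nth2; rewrite length_map, length_seq; [|lia].
    replace (r + j - r)%nat with j by lia.
    rewrite nth_map_seq by lia. simpl. ring.
Qed.

Lemma inc_code_pt (r : nat) (c : list Z) (x : Z) : (1 <= r)%nat ->
  fst (pt_of r (code_pt r c x)) 1%nat = IZR x /\
  inc r (pt_of r (code_pt r c x)) (ln_of r c).
Proof.
  intros Hr.
  assert (E1 : fst (pt_of r (code_pt r c x)) 1%nat = IZR x).
  { cbn [pt_of fst]. rewrite pt_v_code_pt by lia. f_equal. cbn. ring. }
  split; [assumption|]. split; intros j Hj; [rewrite E1|]; cbn [pt_of ln_of fst snd].
  - rewrite <- mult_IZR, <- plus_IZR. f_equal. apply pt_v_code_pt. lia.
  - rewrite <- mult_IZR, <- plus_IZR. f_equal. apply pt_w_code_pt. lia.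
Qed.

Lemma Forall2_map_same {A B C : Type} (R : B -> C -> Prop) (f : A -> B) (g : A -> C) (s : list A) :
  (forall a, In a s -> R (f a) (g a)) -> Forall2 R (map f s) (map g s).
Proof.
  induction s as [|a s IH]; intros H; simpl; constructor; [apply H; now left|].
  apply IH; intros; apply H; now right.
Qed.

Lemma Forall2_nth_Z (c : list Z) (bs : list nat) :
  Forall2 (fun x b => (Z.abs x <= Z.of_nat b)%Z) c bs ->
  forall i, (Z.abs (nth i c 0%Z) <= Z.of_nat (nth i bs 0%nat))%Z.
Proof.
  induction 1 as [|x b c bs Hx Hc IH]; intros [|i]; simpl; auto; lia.
Qed.

Definition codes (r K T : nat) : list (list Z) :=
  box (map (fun j => K * T ^ j)%nat (exponents r)).

Lemma length_code (r K T : nat) (c : list Z) :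
  In c (codes r K T) -> length c = (r + (r - 3))%nat.
Proof.
  intros H. apply in_box, Forall2_length in H. rewrite H.
  unfold exponents. now rewrite length_map, length_app, !length_seq.
Qed.

Lemma ln_bounds (r T : nat) (c : list Z) : (2 <= r)%nat -> In c (codes r 1 T) ->
  (forall j, (j <= r)%nat -> (Z.abs (ln_v c j) <= Z.of_nat T ^ Z.of_nat j)%Z) /\
  (forall j, (j < r)%nat -> (Z.abs (ln_w r c j) <= Z.of_nat T ^ Z.of_nat j)%Z).
Proof.
  intros Hr Hc. apply in_box in Hc. pose proof (Forall2_nth_Z _ _ Hc) as H.
  unfold exponents in H. rewrite map_app in H.
  assert (H1 : forall i, (i < r)%nat -> (Z.abs (nth i c 0) <= Z.of_nat T ^ Z.of_nat (S i))%Z).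
  { intros i Hi. specialize (H i).
    rewrite app_nth1 in H by (rewrite length_map, length_seq; lia).
    rewrite nth_map_seq in H by lia. rewrite Nat.mul_1_l, Nat2Z.inj_pow in H. exact H. }
  assert (H2 : forall i, (3 + i < r)%nat ->
    (Z.abs (nth (r + i) c 0) <= Z.of_nat T ^ Z.of_nat (3 + i))%Z).
  { intros i Hi. specialize (H (r + i)%nat).
    rewrite app_nth2 in H by (rewrite length_map, length_seq; lia).
    rewrite length_map, length_seq in H.
    replace (r + i - r)%nat with i in H by lia.
    rewrite nth_map_seq in H by lia. rewrite Nat.mul_1_l, Nat2Z.inj_pow in H. exact H. }
  split; intros j Hj.
  - destruct j as [|[|j]]; cbn [ln_v].
    + simpl. lia.
    + pose proof (Z.pow_nonneg (Z.of_nat T) (Z.of_nat 1)). lia.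
    + apply H1. lia.
  - unfold ln_w. destruct j as [|[|[|j]]]; cbn [common_w].
    + simpl. lia.
    + apply H1. lia.
    + rewrite Z.abs_opp. apply H1. lia.
    + apply H2. lia.
Qed.

(** The v entries are at most T^j + T T^(j-1) = 2 T^j, hence the w entries at most T^j + T (2
    T^(j-1)) = 3 T^j; this is where the factor 3 for points comes from. *)
Lemma code_pt_in (r T : nat) (c : list Z) (x : Z) : (2 <= r)%nat ->
  In c (codes r 1 T) -> In x (zrange T) -> In (code_pt r c x) (codes r 3 T).
Proof.
  intros Hr Hc Hx. apply in_zrange in Hx. destruct (ln_bounds r T c Hr Hc) as [Bv Bw].
  set (t := Z.of_nat T) in *.
  assert (Hpow : forall j, (t ^ Z.of_nat (S j) = t * t ^ Z.of_nat j)%Z)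
    by (intros j; rewrite Nat2Z.inj_succ; apply Z.pow_succ_r; lia).
  assert (Hpos : forall j, (0 <= t ^ Z.of_nat j)%Z) by (intros; apply Z.pow_nonneg; lia).
  assert (BV : forall j, (S j <= r)%nat ->
    (Z.abs (ln_v c (S j) + x * ln_w r c j) <= 2 * t ^ Z.of_nat (S j))%Z).
  { intros j Hj. specialize (Bv (S j) Hj). specialize (Bw j Hj).
    assert (Z.abs (x * ln_w r c j) <= t * t ^ Z.of_nat j)%Z
      by (rewrite Z.abs_mul; apply Z.mul_le_mono_nonneg; lia).
    rewrite Hpow in *. lia. }
  apply in_box. unfold code_pt, exponents. rewrite map_app.
  apply Forall2_app; apply Forall2_map_same; intros j Hj; apply in_seq in Hj;
    rewrite Nat2Z.inj_mul, Nat2Z.inj_pow; fold t.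
  - destruct j as [|j]; [lia|]. specialize (BV j ltac:(lia)). specialize (Hpos (S j)). lia.
  - destruct j as [|[|j]]; [lia|lia|]. replace (S (S j) - 1)%nat with (S j) by lia.
    specialize (BV j ltac:(lia)). pose proof (Bw 1%nat ltac:(lia)) as B1.
    specialize (Bw (S (S j)) ltac:(lia)).
    rewrite Z.pow_1_r in B1. set (y := (ln_v c (S j) + x * ln_w r c j)%Z) in *.
    assert (Z.abs (ln_w r c 1 * y) <= t * (2 * t ^ Z.of_nat (S j)))%Z
      by (rewrite Z.abs_mul; apply Z.mul_le_mono_nonneg; lia).
    rewrite (Hpow (S j)) in *. lia.
Qed.

Lemma separated_map (r : nat) (F : list Z -> config) (S : list (list Z)) :
  NoDup S -> (forall c c', In c S -> In c' S -> agree r (F c) (F c') -> c = c') ->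
  separated r (map F S).
Proof.
  intros HS. induction HS as [|c S Hc HS IH]; intros H; simpl; constructor.
  - apply Forall_forall. intros q Hq E. apply in_map_iff in Hq. destruct Hq as (c' & <- & Hc').
    apply Hc. rewrite (H c c'); simpl; auto.
  - apply IH. intros; apply H; simpl; auto.
Qed.

(** Points fill the box with factor 3 and lines that with factor 1, so each line keeps all its
    points with |v_1| at most T. The base 9 is 3 K for K = 3. *)
Lemma box_arrangement (r T : nat) : (3 <= r)%nat -> (1 <= T)%nat ->
  exists P L, arrangement (2 * r + 2) P L /\
    (length P <= 9 ^ length (exponents r) * T ^ list_sum (exponents r))%nat /\
    (length L <= 9 ^ length (exponents r) * T ^ list_sum (exponents r))%nat /\
    (T ^ S (list_sum (exponents r)) <= num_incidences P L)%nat.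
Proof.
  intros Hr HT.
  destruct (plane_realization r (map (pt_of r) (codes r 3 T)) (map (ln_of r) (codes r 1 T)))
    as (x & H).
  - lia.
  - apply Forall_map, Forall_forall. intros; apply pt_of_config.
  - apply Forall_map, Forall_forall. intros; apply ln_of_config.
  - apply separated_map; [apply NoDup_box|]. intros c c' Hc Hc'.
    apply pt_of_inj; eapply length_code; eassumption.
  - apply separated_map; [apply NoDup_box|]. intros c c' Hc Hc'.
    apply ln_of_inj; [lia|eapply length_code; eassumption..].
  - eexists _, _. split; [exact H|]. clear H.
    rewrite !length_map.
    destruct (length_box_powers 3 T (exponents r)) as [_ H3]; [lia|assumption|].
    destruct (length_box_powers 1 T (exponents r)) as [H1 H1']; [lia|assumption|].
    fold (codes r 3 T) in H3. fold (codes r 1 T) in H1, H1'.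
    split; [exact H3|]. split.
    + apply Nat.le_trans with (1 := H1'). apply Nat.mul_le_mono_r, Nat.pow_le_mono_l. lia.
    + apply Nat.le_trans with (T * length (codes r 1 T))%nat; [rewrite Nat.pow_succ_r'; nia|].
      rewrite <- (length_map (ln_of r)), <- (length_map (plane_ln x r)).
      apply num_incidences_ge. intros l Hl. rewrite map_map in Hl.
      apply in_map_iff in Hl. destruct Hl as (c & <- & Hc).
      (* The points of the line with integer abscissa b in [-T, T]. *)
      exists (map (fun b => plane_pt x r (pt_of r (code_pt r c b))) (zrange T)).
      repeat split.
      * apply NoDup_map_NoDup_ForallPairs; [|apply NoDup_zrange].
        intros b b' _ _ E. unfold plane_pt in E. apply (f_equal fst) in E. cbn [fst] in E.
        rewrite (proj1 (inc_code_pt r c b ltac:(lia))), (proj1 (inc_code_pt r c b' ltac:(lia))) in E.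
        now apply eq_IZR.
      * intros p Hp. apply in_map_iff in Hp. destruct Hp as (b & <- & Hb).
        apply in_map, in_map, code_pt_in; auto; lia.
      * intros p Hp. apply in_map_iff in Hp. destruct Hp as (b & <- & Hb).
        unfold plane_pt. apply on_plane_ln, height_agree.
        apply inc_line_pt; [lia|apply pt_of_config|apply ln_of_config|].
        apply inc_code_pt. lia.
      * rewrite length_map, length_zrange. lia.
Qed.

(** * Choice of T for given n, and the exponent *)

Lemma flag_arrangement (g : nat) : exists P L, arrangement g P L /\
  length P = 1%nat /\ length L = 1%nat /\ (1 <= num_incidences P L)%nat.
Proof.
  exists ((0, 0) :: nil), ((0, 1, 0) :: nil). repeat split.
  - repeat constructor. simpl; tauto.
  - intros [|j] Hj; simpl in *; [lra|lia].
  - intros i j Hij Hj. simpl in Hj. lia.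
  - intros m (Hm & f & Hinj & Hadj). exfalso.
    assert (H : forall i, (i < m)%nat -> f i = inl 0%nat \/ f i = inr 0%nat).
    { intros i Hi. specialize (Hadj i Hi). unfold incidence_adj in Hadj. simpl in Hadj.
      destruct (f i) as [a|a], (f _) as [b|b]; try tauto; [left|right]; f_equal; lia. }
    assert (H01 : f 0%nat <> f 1%nat) by (intros E; apply Hinj in E; lia).
    assert (H02 : f 0%nat <> f 2%nat) by (intros E; apply Hinj in E; lia).
    assert (H12 : f 1%nat <> f 2%nat) by (intros E; apply Hinj in E; lia).
    destruct (H 0%nat), (H 1%nat), (H 2%nat); try lia; congruence.
  - unfold num_incidences. cbn [map list_sum fold_right].
    rewrite on_line_inc_ind; [lia|]. simpl. ring.
Qed.

(** T is found by descent from a value so large that D (T + 1)^e exceeds n. *)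
Lemma power_bracket (D e n : nat) : (1 <= D)%nat -> (1 <= e)%nat -> (D <= n)%nat ->
  exists T, (1 <= T)%nat /\ (D * T ^ e <= n)%nat /\ (n < D * S T ^ e)%nat.
Proof.
  intros HD He Hn.
  assert (H : forall m, (n < D * S (S m) ^ e)%nat ->
    exists T, (1 <= T)%nat /\ (D * T ^ e <= n)%nat /\ (n < D * S T ^ e)%nat).
  { induction m as [|m IH]; intros Hm.
    - exists 1%nat. rewrite Nat.pow_1_l. repeat split; lia.
    - destruct (le_lt_dec (D * S (S m) ^ e) n) as [H|H]; [|auto].
      exists (S (S m)). repeat split; try assumption; lia. }
  apply (H n).
  assert (S (S n) ^ 1 <= S (S n) ^ e)%nat by (apply Nat.pow_le_mono_r; lia).
  rewrite Nat.pow_1_r in *. nia.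
Qed.

Lemma list_sum_seq (a n : nat) : (2 * list_sum (seq a n) + n = n * (2 * a + n))%nat.
Proof.
  revert a. induction n as [|n IH]; intros a; [reflexivity|].
  cbn [seq]. change (list_sum (a :: seq (S a) n)) with (a + list_sum (seq (S a) n))%nat.
  specialize (IH (S a)). nia.
Qed.

(** 1 + ... + r and 3 + ... + (r - 1) add up to r(r+1)/2 + r(r-1)/2 - 3. *)
Lemma sum_exponents (r : nat) : (3 <= r)%nat -> (list_sum (exponents r) + 3 = r * r)%nat.
Proof.
  intros Hr. unfold exponents. rewrite list_sum_app.
  pose proof (list_sum_seq 1 r). pose proof (list_sum_seq 3 (r - 3)).
  assert (exists q, r = q + 3)%nat as [q ->] by (exists (r - 3)%nat; lia).
  rewrite Nat.add_sub in *. nia.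
Qed.

Lemma arrangement_sequence (r : nat) : (3 <= r)%nat ->
  let e := (r * r - 3)%nat in
  exists D, (1 <= D)%nat /\ forall n, (1 < n)%nat ->
    exists T P L, (1 <= T)%nat /\ (n <= D * T ^ e)%nat /\
      arrangement (2 * r + 2) P L /\ length P = n /\ length L = n /\
      (T ^ S e <= num_incidences P L)%nat.
Proof.
  intros Hr e.
  assert (He' : list_sum (exponents r) = e) by (pose proof (sum_exponents r Hr); lia).
  set (D := (9 ^ length (exponents r))%nat).
  assert (HD : (1 <= D)%nat) by (pose proof (Nat.pow_nonzero 9 (length (exponents r))); lia).
  assert (H2 : (1 <= 2 ^ e)%nat) by (pose proof (Nat.pow_nonzero 2 e); lia).
  (* The factor 2^e absorbs the step from T + 1 to 2 T in n < D (T + 1)^e. *)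
  exists (D * 2 ^ e)%nat. split; [nia|]. intros n Hn.
  assert (He1 : (1 <= e)%nat) by nia.
  destruct (le_lt_dec D n) as [HDn|HDn].
  - destruct (power_bracket D e n HD He1 HDn) as (T & HT & Hle & Hlt).
    destruct (box_arrangement r T Hr HT) as (P & L & Hg & HP & HL & HI).
    rewrite He' in HP, HL, HI. fold D in HP, HL.
    destruct (pad_arrangement _ n P L Hg) as (P' & L' & Hg' & HP' & HL' & HI'); [lia|lia|].
    exists T, P', L'. repeat split; try assumption; try apply Hg'; [|lia].
    assert (S T ^ e <= (2 * T) ^ e)%nat by (apply Nat.pow_le_mono_l; lia).
    rewrite Nat.pow_mul_l in *. nia.
  (* For n below D no box need fit: with T = 1 a single incidence suffices. *)
  - destruct (flag_arrangement (2 * r + 2)) as (P & L & Hg & HP & HL & HI).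
    destruct (pad_arrangement _ n P L Hg) as (P' & L' & Hg' & HP' & HL' & HI'); [lia|lia|].
    exists 1%nat, P', L'. rewrite !Nat.pow_1_l.
    repeat split; try assumption; try apply Hg'; try lia. nia.
Qed.

(** Raising n <= D T^e to the power 1 + 1/e gives T^(e+1) times D^(1+1/e), and the latter is at most
    D^2. *)
Lemma Rpower_le_of_bracket (D n T e : nat) :
  (1 <= D)%nat -> (1 <= T)%nat -> (1 <= e)%nat -> (1 <= n)%nat -> (n <= D * T ^ e)%nat ->
  / (INR D * INR D) * Rpower (INR n) (1 + / INR e) <= INR (T ^ S e).
Proof.
  intros HD HT He Hn Hle.
  apply le_INR in HD, HT, He, Hn, Hle. rewrite mult_INR, pow_INR in Hle.
  change (INR 1) with 1 in *.
  assert (Hi : 0 < / INR e <= 1).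
  { split; [apply Rinv_0_lt_compat; lra|]. rewrite <- Rinv_1. apply Rinv_le_contravar; lra. }
  assert (HTe : 0 < INR T ^ e) by (apply pow_lt; lra).
  assert (H1 : Rpower (INR n) (1 + / INR e) <= Rpower (INR D * INR T ^ e) (1 + / INR e))
    by (apply Rle_Rpower_l; lra).
  rewrite <- Rpower_mult_distr in H1 by lra.
  assert (HDp : Rpower (INR D) (1 + / INR e) <= INR D * INR D).
  { apply Rle_trans with (Rpower (INR D) 2).
    - destruct HD as [HD|HD].
      + apply Rle_Rpower; lra.
      + rewrite <- HD. unfold Rpower. rewrite ln_1, !Rmult_0_r. lra.
    - rewrite (Rpower_pow 2) by lra. simpl. lra. }
  assert (HTp : Rpower (INR T ^ e) (1 + / INR e) = INR T ^ S e).
  { rewrite <- !Rpower_pow by lra. rewrite Rpower_mult. f_equal.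
    rewrite S_INR. field. lra. }
  rewrite HTp in H1. rewrite pow_INR.
  assert (HTS : 0 < INR T ^ S e) by (apply pow_lt; lra).
  assert (HDD : 0 < INR D * INR D) by nra.
  apply Rmult_le_reg_l with (INR D * INR D); [assumption|].
  rewrite <- Rmult_assoc, Rinv_r, Rmult_1_l by lra.
  apply Rle_trans with (1 := H1). apply Rmult_le_compat_r; lra.
Qed.

Theorem theorem1p2 (k : nat) (hk3 : (3 <= k)%nat) (hkodd : Nat.Odd k) :
  exists c : R, 0 < c /\
    forall n : nat, (1 < n)%nat ->
      exists (P : list point) (L : list line),
        length P = n /\ length L = n /\
        distinct_points P /\ distinct_lines L /\
        girth_at_least (incidence_adj P L) (k + 5) /\
        INR (num_incidences P L) >=
          c * Rpower (INR n) (1 + 4 / INR (k * k + 6 * k - 3)).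
Proof.
  destruct hkodd as [q Hq].
  (* With k = 2q + 1, the parameter r = (k + 3)/2 is q + 2. *)
  assert (Hr : (3 <= q + 2)%nat) by lia.
  destruct (arrangement_sequence (q + 2) Hr) as (D & HD & H). set (e := (_ - 3)%nat) in H.
  assert (He : (1 <= e)%nat) by (unfold e; nia).
  exists (/ (INR D * INR D)). split.
  { apply le_INR in HD. simpl in HD. apply Rinv_0_lt_compat. nra. }
  intros n Hn. destruct (H n Hn) as (T & P & L & HT & Hle & (HP & HL & Hg) & HPn & HLn & HI).
  exists P, L. replace (k + 5)%nat with (2 * (q + 2) + 2)%nat by lia.
  repeat (split; [assumption|]).
  (* Both sides equal 4 q^2 + 16 q + 4. *)
  replace (k * k + 6 * k - 3)%nat with (4 * e)%nat by (unfold e; nia).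
  replace (4 / INR (4 * e)) with (/ INR e).
  - apply Rle_ge. apply Rle_trans with (INR (T ^ S e)).
    + apply Rpower_le_of_bracket; lia.
    + now apply le_INR.
  - apply le_INR in He. rewrite mult_INR. simpl (INR 4). simpl (INR 1) in He. field. lra.
Qed.
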